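(* Let $P_0,P_1,P_2,P_3$ be a non-degenerate quadrilateral in $\mathbb{RP}^2$, i.e. four points no three of which are collinear, and let $O$ be the intersection point of its diagonals $P_0P_2$ and $P_1P_3$. Then the centrally-projective polygon $\mathrm{CPol}(O;P_0,P_1,P_2,P_3)$ is $4$-reflective.
   Context: All objects live in the real projective plane $\mathbb{RP}^2$ (containing $\mathbb{R}^2$ as an affine chart). Projective reflection law: let $p$ be a point and let $T\neq L$ be two lines through $p$ ($T$ is the edge, $L$ the transverse line at $p$). A line $\ell$ through $p$ is reflected into the line $\ell'$ through $p$ if $(\ell,\ell',L,T)$ is harmonic, i.e. has cross-ratio $-1$ (the cross-ratio of four lines through $p$ is the cross-ratio of their intersection points with any fifth line not passing through $p$). Equivalently, $\ell\mapsto \ell'$ is the non-trivial projective involution of the pencil of lines through $p$ fixing $L$ and $T$ (so $L$ and $T$ are reflected into themselves). Polygonal projective billiard: a polygon with vertices $P_0,\dots,P_{n-1}$ (indices modulo $n$), whose edges are the whole lines $\gamma_k=P_kP_{k+1}$, each edge being endowed with a field of transverse lines $M\mapsto L_k(M)\ni M$ for $M\in\gamma_k$. Orbit: for distinct points $M_0\in P_0P_1$, $M_1\in P_1P_2$, the orbit of $(M_0,M_1)$ is the sequence $(M_k)_{k\in\mathbb{Z}}$ with $M_k\in P_kP_{k+1}$ (indices of $P$ modulo $n$) such that for each $k$ the line $M_{k-1}M_k$ is reflected into the line $M_kM_{k+1}$ by the projective reflection law at $M_k$ with edge $\gamma_k$ and transverse line $L_k(M_k)$. Obstacles between consecutive edges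 are ignored. For $m$ a positive multiple of $n$, the orbit is $m$-periodic if the lines $M_mM_{m+1}$ and $M_0M_1$ coincide. The billiard is $m$-reflective if there is a non-empty open subset $U\times V\subset P_0P_1\times P_1P_2$ such that the orbit of every $(M_0,M_1)\in U\times V$ is $m$-periodic. Centrally-projective polygon $\mathrm{CPol}(O;P_0,\dots,P_{n-1})$: the polygonal projective billiard on $P_0\cdots P_{n-1}$ in which the transverse line at $M\in\gamma_i=P_iP_{i+1}$ is $L_i(M)=MO$, the line joining $M$ to the point $O$ (the origin), where $O$ does not lie on any edge $\gamma_i$. *)

(* Defs.v *)
From HB Require Import structures.
From mathcomp Require Import all_boot all_order all_algebra.
From mathcomp Require Import all_classical all_reals all_analysis.

Set Implicit Arguments.
Unset Strict Implicit.
Unset Printing Implicit Defensive.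

Import Order.TTheory GRing.Theory Num.Theory.
Import numFieldNormedType.Exports.
Local Open Scope classical_set_scope.
Local Open Scope ring_scope.

(* The real projective plane is the plane of linear subspaces of R^3: points
   are vector lines, lines are vector planes, incidence is inclusion, the line
   joining p and q is (p + q)%VS and the intersection of two lines l and m is
   (l :&: m)%VS. *)

Section ProjectivePlane.
Variable R : realType.

Record ppoint := PPoint {
  point_space :> {vspace 'rV[R]_3};
  dim_ppoint : \dim point_space == 1%N }.

HB.instance Definition _ := [isSub for point_space].
HB.instance Definition _ := [Choice of ppoint by <:].

Definition is_line (l : {vspace 'rV[R]_3}) : Prop := \dim l = 2%N.

Definition points_on (l : {vspace 'rV[R]_3}) : set ppoint :=
  [set M | (M <= l)%VS].

(* The quotient topology of R^3 \ {0} -> RP^2; as R^3 \ {0} is open, the cone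
   over W is open in it iff it is open in R^3. *)
Definition cone (W : set ppoint) : set 'rV[R]_3 :=
  [set v | exists2 p, W p & (p : {vspace _}) = <[v]>%VS].

Definition point_open (W : set ppoint) : Prop := open (cone W).

Lemma point_of_vec (v : 'rV[R]_3) : v != 0 ->
  exists p : ppoint, (p : {vspace _}) = <[v]>%VS.
Proof.
move=> v0; have d : \dim <[v]>%VS == 1%N by rewrite dim_vline v0.
by exists (PPoint d).
Qed.

Lemma cone_neq0 (W : set ppoint) v : cone W v -> v != 0.
Proof.
by case=> p _ pv; have := dim_ppoint p; rewrite pv dim_vline; case: (v != 0).
Qed.

Fact point_openT : point_open setT.
Proof.
rewrite /point_open (_ : cone setT = ~` [set 0]).
  by apply: closed_openC; apply: accessible_closed_set1;
       apply: hausdorff_accessible; exact: norm_hausdorff.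
apply/seteqP; split=> v /=; first by move=> /cone_neq0/eqP.
by move=> /eqP/point_of_vec[p pv]; exists p.
Qed.

Fact point_openI : setI_closed point_open.
Proof.
move=> A B oA oB; rewrite /point_open (_ : cone _ = cone A `&` cone B).
  exact: openI.
apply/seteqP; split=> v /=.
  by case=> p [Ap Bp] pv; split; exists p.
case=> -[p Ap pv] [q Bq qv]; exists p => //; split=> //.
by rewrite (_ : p = q) //; apply: val_inj; rewrite /= pv qv.
Qed.

Fact point_open_bigU (I : Type) (f : I -> set ppoint) :
  (forall i, point_open (f i)) -> point_open (\bigcup_i f i).
Proof.
move=> fo; rewrite /point_open (_ : cone _ = \bigcup_i cone (f i)).
  by apply: bigcup_open => i _; exact: fo.
apply/seteqP; split=> v /=.
  by case=> p [i _ fip] pv; exists i => //; exists p.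
by case=> i _ [p fip pv]; exists p => //; exists i.
Qed.

HB.instance Definition _ :=
  isOpenTopological.Build ppoint point_openT point_openI point_open_bigU.

(* For collinear points a, b, c, d, the vector o is taken off the line that
   carries them. On this line det3 o is an area form, hence unique up to a
   factor that cancels in the cross-ratio, as do the factors coming from the
   choice of representatives. In an affine coordinate of the line this is
   ((c - a) (d - b)) / ((c - b) (d - a)). The value is 0 if a denominator
   vanishes. *)
Definition det3 (u v w : 'rV[R]_3) : R :=
  \det (col_mx u (col_mx v w) : 'M[R]_3).

Definition cross_ratio (a b c d : {vspace 'rV[R]_3}) : R :=
  let o := vpick ((a + b + c + d)^C)%VS in
  let br (x y : {vspace 'rV[R]_3}) := det3 o (vpick x) (vpick y) in
  (br a c * br b d) / (br b c * br a d).

Definition pencil_cross_ratio_eq (p : ppoint)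
    (l1 l2 l3 l4 : {vspace 'rV[R]_3}) (x : R) : Prop :=
  forall m : {vspace 'rV[R]_3}, is_line m -> ~~ (p <= m)%VS ->
    cross_ratio (l1 :&: m)%VS (l2 :&: m)%VS (l3 :&: m)%VS (l4 :&: m)%VS = x.

(* The cross-ratio (l, l', L, T) is undefined for l = l' = L and for
   l = l' = T, so the fixed lines of the reflection are listed apart. *)
Definition reflected (p : ppoint) (T L l l' : {vspace 'rV[R]_3}) : Prop :=
  [/\ is_line l, is_line l', (p <= l)%VS, (p <= l')%VS &
    pencil_cross_ratio_eq p l l' L T (-1)
    \/ (l = l' /\ (l = L \/ l = T))].

(* 'Z_n is the ring of integers modulo n because 2 < n. *)
Record billiard (n : nat) := Billiard {
  vertex : 'Z_n -> ppoint;
  transverse : 'Z_n -> ppoint -> {vspace 'rV[R]_3};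
  edge := fun k : 'Z_n => (vertex k + vertex (k + 1)%R)%VS;
  billiard_size : (2 < n)%N;
  vertex_neq : forall k, vertex k <> vertex (k + 1);
  transverseP : forall (k : 'Z_n) (M : ppoint), (M <= edge k)%VS ->
    [/\ is_line (transverse k M), (M <= transverse k M)%VS &
        transverse k M <> edge k] }.

Definition is_orbit n (B : billiard n) (M : int -> ppoint) : Prop :=
  forall k : int,
    [/\ (M k <= edge B k%:~R)%VS,
        M k <> M (k + 1) &
        reflected (M k) (edge B k%:~R) (transverse B k%:~R (M k))
          (M (k - 1)%R + M k)%VS (M k + M (k + 1)%R)%VS].

Definition orbit_of n (B : billiard n) (M0 M1 : ppoint) (M : int -> ppoint) :
    Prop :=
  [/\ M 0 = M0, M 1 = M1 & is_orbit B M].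

Definition periodic_orbit (m : nat) (M : int -> ppoint) : Prop :=
  (M m%:Z + M (m%:Z + 1)%R)%VS = (M 0%R + M 1%R)%VS.

Definition reflective n (B : billiard n) (m : nat) : Prop :=
  [/\ (0 < m)%N, (n %| m)%N &
    exists U V : set ppoint,
      [/\ U `<=` points_on (edge B 0) /\ V `<=` points_on (edge B 1),
          open (U : set (subspace (points_on (edge B 0)))) /\
            open (V : set (subspace (points_on (edge B 1)))),
          U !=set0 /\ V !=set0 &
          forall M0 M1, U M0 -> V M1 ->
            exists M, unique (orbit_of B M0 M1) M /\ periodic_orbit m M]].

Lemma dim_join (p q : ppoint) : p <> q -> is_line (p + q)%VS.
Proof.
move=> pq; have /eqP dp := dim_ppoint p; have /eqP dq := dim_ppoint q.
have [c0|c0] := posnP (\dim (p :&: q)%VS).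
  by have := dimv_sum_cap p q; rewrite c0 dp dq addn0.
have cp : (p :&: q)%VS = p by apply/eqP; rewrite eqEdim capvSl dp.
have cq : (p :&: q)%VS = q by apply/eqP; rewrite eqEdim capvSr dq.
by case: pq; apply: val_inj; rewrite /= -[LHS]cp cq.
Qed.

Section CentrallyProjective.
Variables (n : nat) (P : 'Z_n -> ppoint) (O : ppoint).
Hypothesis n_gt2 : (2 < n)%N.
Hypothesis P_neq : forall k, P k <> P (k + 1).
Hypothesis O_off : forall k, ~~ (O <= P k + P (k + 1)%R)%VS.

Fact cpol_transverseP (k : 'Z_n) (M : ppoint) : (M <= P k + P (k + 1)%R)%VS ->
  [/\ is_line (M + O)%VS, (M <= M + O)%VS &
      (M + O)%VS <> (P k + P (k + 1)%R)%VS].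
Proof.
move=> Mk; split; last 2 first.
- exact: addvSl.
- by move=> e; move: (O_off k); rewrite -e addvSr.
by apply: dim_join => MO; move: (O_off k); rewrite -MO Mk.
Qed.

Definition CPol : billiard n :=
  @Billiard n P (fun _ M => (M + O)%VS) n_gt2 P_neq cpol_transverseP.

End CentrallyProjective.

Definition collinear (p q r : ppoint) : Prop :=
  exists l, [/\ is_line l, (p <= l)%VS, (q <= l)%VS & (r <= l)%VS].

Definition nondegenerate_quad (P : 'Z_4 -> ppoint) : Prop :=
  forall i j k, i != j -> j != k -> i != k -> ~ collinear (P i) (P j) (P k).

Lemma collinear_eq (p q r : ppoint) : p = q -> collinear p q r.
Proof.
move=> <-; have [pr|/dim_join pr] := pselect (p = r); last first.
  by exists (p + r)%VS; rewrite addvSl addvSr.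
have : exists q : ppoint, p <> q.
  have /vspaceP np : (p : {vspace _}) <> fullv.
    by move=> e; have := dim_ppoint p; rewrite e dimvf.
  have [v vp] : exists v, v \notin (p : {vspace _}).
    apply: contrapT => h; apply: np => v; rewrite memvf.
    by apply/negPn/negP => vp; apply: h; exists v.
  have [|s sv] := @point_of_vec v.
    by apply: contraNneq vp => ->; exact: mem0v.
  by exists s => ps; move: vp; rewrite ps sv memv_line.
case=> s /dim_join ps; exists (p + s)%VS; rewrite -pr.
by rewrite addvSl.
Qed.

Lemma quad_vertex_neq (P : 'Z_4 -> ppoint) :
  nondegenerate_quad P -> forall k, P k <> P (k + 1).
Proof.
move=> nd k e; apply: (nd k (k + 1) (k + 2)); last exact: collinear_eq.
- by case: k {e} => -[|[|[|[|]]]].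
- by case: k {e} => -[|[|[|[|]]]].
- by case: k {e} => -[|[|[|[|]]]].
Qed.

Lemma diagonals_off_edges (P : 'Z_4 -> ppoint) (O : ppoint) :
  nondegenerate_quad P ->
  (O : {vspace _}) = ((P 0%R + P 2%R) :&: (P 1%R + P 3%R))%VS ->
  forall k, ~~ (O <= P k + P (k + 1)%R)%VS.
Proof.
move=> nd hO k; apply/negP => Ok.
have [Od Oe] : (O <= P k + P (k + 2)%R)%VS /\
               (O <= P (k + 1)%R + P (k + 3)%R)%VS.
  have O02 : (O <= P 0%R + P 2%R)%VS by rewrite hO capvSl.
  have O13 : (O <= P 1%R + P 3%R)%VS by rewrite hO capvSr.
  have P20 := O02; rewrite addvC in P20.
  have P31 := O13; rewrite addvC in P31.
  have to (a b c d : 'Z_4) : a = c -> b = d ->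
    (O <= P c + P d)%VS -> (O <= P a + P b)%VS by move=> -> ->.
  have [->|[->|[->|->]]] : k = 0 \/ k = 1 \/ k = 2 \/ k = 3.
  - case: k {Ok} => -[|[|[|[|//]]]] i.
    + by left; exact: val_inj.
    + by right; left; exact: val_inj.
    + by right; right; left; exact: val_inj.
    + by right; right; right; exact: val_inj.
  - by rewrite !add0r.
  - by split;
      [apply: (to _ _ _ _ _ _ O13)|apply: (to _ _ _ _ _ _ P20)]; apply: val_inj.
  - by split;
      [apply: (to _ _ _ _ _ _ P20)|apply: (to _ _ _ _ _ _ P31)]; apply: val_inj.
  - by split;
      [apply: (to _ _ _ _ _ _ P31)|apply: (to _ _ _ _ _ _ O02)]; apply: val_inj.
have ne (a b : 'Z_4) : a != b -> k + a != k + b.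
  by rewrite (inj_eq (addrI k)).
have ne0 (b : 'Z_4) : 0 != b -> k != k + b.
  by rewrite -{1}[k]addr0; exact: ne.
have nc1 : ~ collinear (P k) (P (k + 1)) (P (k + 2)).
  by apply: nd; [exact: ne0|exact: ne|exact: ne0].
have nc2 : ~ collinear (P k) (P (k + 1)) (P (k + 3)).
  by apply: nd; [exact: ne0|exact: ne|exact: ne0].
have line_eq (p q : ppoint) l : is_line l -> p <> q -> (p <= l)%VS ->
    (q <= l)%VS -> l = (p + q)%VS.
  move=> dl /dim_join dpq pl ql; apply/esym/eqP.
  by rewrite eqEdim subv_add pl ql /= dl dpq.
have l01 : is_line (P k + P (k + 1)%R)%VS.
  by apply: dim_join; exact: quad_vertex_neq.
have OP0 : O = P k.
  apply: contrapT => OP; apply: nc1; exists (P k + P (k + 1)%R)%VS.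
  split; rewrite ?addvSl ?addvSr //.
  have l02 : is_line (P k + P (k + 2)%R)%VS.
    apply: dim_join => e; apply: (nd k (k + 2) (k + 1)) (collinear_eq _ e).
    - exact: ne0.
    - exact: ne.
    - exact: ne0.
  rewrite (line_eq _ _ _ l01 OP) ?addvSl // -(line_eq _ _ _ l02 OP) ?addvSl //.
  exact: addvSr.
apply: nc2; exists (P (k + 1)%R + P (k + 3)%R)%VS; rewrite -OP0 Oe.
split; rewrite ?addvSl ?addvSr //; apply: dim_join => e.
apply: (nd (k + 1) (k + 3) k) (collinear_eq _ e); last 2 first.
- by rewrite eq_sym; exact: ne0.
- by rewrite eq_sym; exact: ne0.
- exact: ne.
Qed.

End ProjectivePlane.

(* Main.v *)
Require Import Defs.
From mathcomp Require Import all_boot all_order all_algebra.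
From mathcomp Require Import all_classical all_reals all_analysis.
From mathcomp Require Import ring lra.

Import Order.TTheory GRing.Theory Num.Theory.
Import numFieldNormedType.Exports.
Local Open Scope ring_scope.

(* Vectors v_k spanning the P_k can be scaled so that v_0 + v_2 = v_1 + v_3 = o
   spans O. At every point of the edge f_k = 0, where f_k is the linear form
   with f_k(o) = 1, the reflection is induced by the harmonic homology
   x |-> x - 2 f_k(x) o. Hence, for points M_k = <s_k v_k + t_k v_(k+1)>, the
   reflection at M_k reads
     s_(k-1) s_k s_(k+1) = t_(k+1) (s_(k-1) s_k + t_(k-1) t_k - s_(k-1) t_k),
   a relation which determines M_(k+1), and also M_(k-1), as long as no point is
   a vertex. Starting from (s_0, t_0) = (a, b) and (s_1, t_1) = (c, d), it gives
   (s_2, t_2) = (Q, a c), (s_3, t_3) = (b d, Q) with Q = a c + b d - a d, and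
   then (a, b) again up to a factor. The open conditions a (b - a) > 0 and
   c d > 0 make all these coefficients nonzero. *)

(** * Homogeneous coordinates, cross-ratios and the harmonic reflection *)

Section Coordinates.
Set Implicit Arguments.
Unset Strict Implicit.
Unset Printing Implicit Defensive.
Variable R : realType.
Implicit Types (u v w x y z e f o : 'rV[R]_3) (m l : {vspace 'rV[R]_3}).
Implicit Types (a b c : R) (p q : ppoint R).

Lemma row3E u v w (A := (col_mx u (col_mx v w) : 'M[R]_3)) :
  [/\ forall j, A 0 j = u 0 j, forall j, A 1 j = v 0 j & forall j, A 2%:R j = w 0 j].
Proof.
have i1 : (1 : 'I_3) = @rshift 1 2 (@lshift 1 1 0) by exact: val_inj.
have i2 : (2%:R : 'I_3) = @rshift 1 2 (@rshift 1 1 0) by exact: val_inj.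
have A0 j : A 0 j = u 0 j by rewrite -(col_mxEu u (col_mx v w)) lshift0.
have A1 j : A 1 j = v 0 j by rewrite i1 [LHS]col_mxEd col_mxEu.
have A2 j : A 2%:R j = w 0 j by rewrite i2 [LHS]col_mxEd col_mxEd.
by [].
Qed.

Lemma det3E u v w : det3 u v w =
  u 0 0 * (v 0 1 * w 0 2%:R - v 0 2%:R * w 0 1)
  - u 0 1 * (v 0 0 * w 0 2%:R - v 0 2%:R * w 0 0)
  + u 0 2%:R * (v 0 0 * w 0 1 - v 0 1 * w 0 0).
Proof.
have detE (A : 'M[R]_3) : \det A =
    A 0 0 * (A 1 1 * A 2%:R 2%:R - A 1 2%:R * A 2%:R 1)
    - A 0 1 * (A 1 0 * A 2%:R 2%:R - A 1 2%:R * A 2%:R 0)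
    + A 0 2%:R * (A 1 0 * A 2%:R 1 - A 1 1 * A 2%:R 0).
  (* With entries indexed by naturals, the ordinals built by [lift] reduce by computation, and
     [ring] recognises equal entries. *)
  have [g gE] : exists g : nat -> nat -> R, forall i j, A i j = g i j.
    by exists (fun i j => A (inord i) (inord j)) => i j; rewrite !inord_val.
  rewrite (expand_det_row _ 0) !big_ord_recl big_ord0 /cofactor.
  rewrite !(expand_det_row _ 0) !big_ord_recl !big_ord0 /cofactor.
  rewrite !det_mx11 !mxE !gE /= /bump /=.
  rewrite !add0n !addr0 !mul1r.
  ring.
have [A0 A1 A2] := row3E u v w.
by rewrite /det3 detE !A0 !A1 !A2.
Qed.

(** The zero vector is allowed, since both sides then vanish; this spares case distinctions for
    degenerate points. *)
Lemma vpick_line u : exists2 k : R, k != 0 & vpick <[u]> = k *: u.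
Proof.
have [->|u0] := eqVneq u 0.
  by exists 1; rewrite ?oner_neq0 // scaler0; apply/eqP; rewrite vpick0 -dimv_eq0 dim_vline eqxx.
have /vlineP[k ek] := memv_pick <[u]>.
exists k => //; apply: contraNneq u0 => k0.
by move/eqP: ek; rewrite k0 scale0r vpick0 -dimv_eq0 dim_vline; case: (u == 0).
Qed.

Lemma ppointE p : (p : {vspace _}) = <[vpick p]>%VS.
Proof.
apply/esym/eqP; rewrite eqEdim -memvE memv_pick dim_vline vpick0 -dimv_eq0.
by rewrite (eqP (dim_ppoint p)).
Qed.

Lemma memv_pair x y z :
  reflect (exists a b, z = a *: x + b *: y) (z \in <[x]> + <[y]>)%VS.
Proof.
apply: (iffP memv_addP) => [[_ /vlineP[a ->]] [_ /vlineP[b ->] ->]|[a [b ->]]].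
  by exists a, b.
exists (a *: x); first exact/memvZ/memv_line.
by exists (b *: y) => //; exact/memvZ/memv_line.
Qed.

Lemma ppoint_on p x y : (p <= <[x]> + <[y]>)%VS ->
  exists a b, [/\ (p : {vspace _}) = <[a *: x + b *: y]>%VS & a *: x + b *: y != 0].
Proof.
rewrite ppointE -memvE => /memv_pair[a [b e]]; exists a, b; rewrite e; split=> //.
by rewrite -e vpick0 -dimv_eq0 (eqP (dim_ppoint p)).
Qed.

Lemma capv_line x m : x \notin m -> (<[x]> :&: m = 0)%VS.
Proof.
move=> xm; apply/eqP; rewrite -subv0; apply/subvP=> w /memv_capP[/vlineP[k ->] km].
have [->|k0] := eqVneq k 0; first by rewrite scale0r mem0v.
by move: xm; rewrite -[x](scalerK k0) memvZ.
Qed.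

Lemma is_line_pair x y : x != 0 -> y \notin <[x]>%VS -> is_line (<[x]> + <[y]>)%VS.
Proof.
move=> x0 yx; rewrite /is_line addvC dimv_disjoint_sum ?capv_line // !dim_vline x0.
by rewrite (_ : y != 0) //; apply: contraNneq yx => ->; exact: mem0v.
Qed.

(** A plane and a vector off it span the whole space. Thus any direction, taken modulo [x], has a
    representative in the transversal [m]. *)
Lemma line_shift m x z : is_line m -> x \notin m -> exists c, z + c *: x \in m.
Proof.
move=> dm xm.
have : (<[x]> + m)%VS == fullv.
  rewrite eqEdim subvf dimvf /dim /= dimv_disjoint_sum ?capv_line // dm dim_vline.
  by rewrite (_ : x != 0) //; apply: contraNneq xm => ->; exact: mem0v.
move=> /eqP fm; have := memvf z; rewrite -fm.
case/memv_addP=> _ /vlineP[k ->] [v vm ->]; exists (- k).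
by rewrite scaleNr addrAC subrr add0r.
Qed.

Lemma line_capv m x z : x \notin m -> z \in m ->
  ((<[x]> + <[z]>) :&: m)%VS = <[z]>%VS.
Proof.
move=> xm zm; by rewrite addvC -vspace_modl -?memvE // capv_line // addv0.
Qed.

Lemma det3_free u v w a b c : det3 u v w != 0 ->
  a *: u + b *: v + c *: w = 0 -> [/\ a = 0, b = 0 & c = 0].
Proof.
move=> d0 e.
have ea : det3 (a *: u + b *: v + c *: w) v w = a * det3 u v w.
  by rewrite !det3E !mxE; ring.
have eb : det3 u (a *: u + b *: v + c *: w) w = b * det3 u v w.
  by rewrite !det3E !mxE; ring.
have ec : det3 u v (a *: u + b *: v + c *: w) = c * det3 u v w.
  by rewrite !det3E !mxE; ring.
have z1 : det3 0 v w = 0 by rewrite det3E !mxE; ring.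
have z2 : det3 u 0 w = 0 by rewrite det3E !mxE; ring.
have z3 : det3 u v 0 = 0 by rewrite det3E !mxE; ring.
by split; apply: (mulIf d0); rewrite mul0r -?ea -?eb -?ec e.
Qed.

Lemma det3_neq0 u v w :
  (forall a b c, a *: u + b *: v + c *: w = 0 -> [/\ a = 0, b = 0 & c = 0]) ->
  det3 u v w != 0.
Proof.
move=> h; apply/negP => /det0P[k k0 ek].
case: (h (k 0 0) (k 0 1) (k 0 2%:R)) => [|a0 b0 c0].
  have [A0 A1 A2] := row3E u v w.
  apply/rowP => j; rewrite -ek !mxE !big_ord_recl big_ord0 addr0 addrA.
  have -> : lift ord0 (ord0 : 'I_2) = 1 :> 'I_3 by exact: val_inj.
  have -> : lift ord0 (lift ord0 (ord0 : 'I_1)) = 2%:R :> 'I_3 by exact: val_inj.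
  by rewrite A0 A1 A2.
move/eqP: k0; apply; apply/rowP => -[[|[|[|//]]] i]; rewrite !mxE.
- by rewrite -[RHS]a0; congr (k _ _); exact: val_inj.
- by rewrite -[RHS]b0; congr (k _ _); exact: val_inj.
- by rewrite -[RHS]c0; congr (k _ _); exact: val_inj.
Qed.

(** Each bracket is a 2 by 2 determinant in the basis [e], [f], multiplied by [det3 o e f] and by
    the scalars of [vpick]. No condition on the coefficients is imposed: if [a' * b] is zero, both
    sides are 0. *)
Lemma cross_ratio_pair e f a b a' b' :
  (forall c d, c *: e + d *: f = 0 -> c = 0 /\ d = 0) ->
  cross_ratio <[a *: f + b *: e]> <[a' *: f + b' *: e]> <[e]> <[f]> =
    (a * b') / (a' * b).
Proof.
move=> ef; rewrite /cross_ratio; cbv beta zeta; set C := (_ ^C)%VS; set o := vpick C.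
(* The last two points already span the carrying line, so the first two do not affect [o]. *)
have eC : C = ((<[e]> + <[f]>)^C)%VS.
  congr (_ ^C)%VS; rewrite -!addvA; apply/eqP; rewrite eqEsubv; apply/andP; split.
    rewrite !subv_add addvSl addvSr !andbT -!memvE.
    by apply/andP; split; apply/memv_pair; [exists b, a|exists b', a']; rewrite addrC.
  by apply: subv_trans (addvSr _ _); exact: addvSr.
have o0 : o != 0.
  rewrite vpick0 eC -dimv_eq0 dimv_compl dimvf /dim /=.
  rewrite -lt0n subn_gt0; apply: leq_ltn_trans (dimv_add_leqif _ _) _.
  by rewrite !dim_vline; do 2!case: (_ != 0).
have D0 : det3 o e f != 0.
  apply: det3_neq0 => k c d; have [->|k0] := eqVneq k 0.
    by rewrite scale0r add0r => /ef[].
  move=> h; have oS : o \in (<[e]> + <[f]>)%VS.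
    rewrite -(scalerK k0 o) memvZ //; apply/memv_pair; exists (- c), (- d).
    by apply/eqP; rewrite -subr_eq0 -h !scaleNr -opprD opprK addrA.
  by move: o0; rewrite -memv0 -(capv_compl (<[e]> + <[f]>)) memv_cap oS -eC memv_pick.
have [k1 k10 ->] := vpick_line (a *: f + b *: e).
have [k2 k20 ->] := vpick_line (a' *: f + b' *: e).
have [k3 k30 ->] := vpick_line e.
have [k4 k40 ->] := vpick_line f.
(* Numerator and denominator share the factor [- K]; its sign comes from exchanging [e] and [f] in
   one bracket of each. *)
set K := k1 * k2 * k3 * k4 * det3 o e f ^+ 2.
have K0 : - K != 0 by rewrite oppr_eq0 !mulf_neq0 ?expf_neq0.
transitivity ((- K * (a * b')) / (- K * (a' * b))).
  by congr (_ / _); rewrite /K !det3E !mxE; ring.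
by rewrite -mulf_div divff // mul1r.
Qed.

Lemma pencil_capE m x e f a b c : x \notin m -> e \in m -> f \in m ->
  ((<[x]> + <[a *: f + b *: e + c *: x]>) :&: m)%VS = <[a *: f + b *: e]>%VS.
Proof.
move=> xm em fm; rewrite -(@line_capv m x (a *: f + b *: e)) ?memvD ?memvZ //; congr (_ :&: _)%VS.
apply/eqP; rewrite eqEsubv !subv_add !addvSl -!memvE /=; apply/andP; split;
  apply/memv_pair.
  by exists c, 1; rewrite scale1r addrC.
by exists (- c), 1; rewrite scale1r scaleNr [RHS]addrC addrK.
Qed.

(** The vector [y] is not a multiple of [x] as soon as one of its coordinates modulo [x] is
    nonzero. *)
Lemma line_pair_neq x y e f a b c :
  (forall a b c, a *: x + b *: f + c *: e = 0 -> [/\ a = 0, b = 0 & c = 0]) ->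
  y = a *: f + b *: e + c *: x ->
  (a != 0) || (b != 0) -> is_line (<[x]> + <[y]>)%VS.
Proof.
move=> fr -> ab; apply: is_line_pair.
  apply/eqP => x0; have [|/eqP] := fr 1 0 0; last by rewrite oner_eq0.
  by rewrite x0 scaler0 !scale0r !addr0.
apply/vlineP => -[k ek]; have [|_ a0 b0] := fr (c - k) a b.
  transitivity ((a *: f + b *: e + c *: x) - k *: x); last by rewrite ek subrr.
  by apply/rowP => r; rewrite !mxE; ring.
by move: ab; rewrite a0 b0 eqxx.
Qed.

Lemma line_pair_shift x z a c : a != 0 ->
  (<[x]> + <[a *: z + c *: x]>)%VS = (<[x]> + <[z]>)%VS.
Proof.
move=> a0; apply/eqP; rewrite eqEsubv !subv_add !addvSl -!memvE /=.
apply/andP; split; apply/memv_pair; first by exists c, a; rewrite addrC.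
by exists (- (a^-1 * c)), a^-1; rewrite scalerDr !scalerA mulVf // scale1r scaleNr addrC addrK.
Qed.

(* Modulo [x], the harmonic reflection sends [a *: t + b *: o] to
   [a *: t - b *: o]; this is compared with [a' *: t + b' *: o]. *)
Lemma reflectedE p x t o y y' a b c a' b' c' :
  (p : {vspace _}) = <[x]>%VS -> det3 x t o != 0 ->
  y = a *: t + b *: o + c *: x -> y' = a' *: t + b' *: o + c' *: x ->
  (a != 0) || (b != 0) -> (a' != 0) || (b' != 0) ->
  reflected p (<[x]> + <[t]>)%VS (<[x]> + <[o]>)%VS (<[x]> + <[y]>)%VS (<[x]> + <[y']>)%VS
  <-> a * b' + a' * b = 0.
Proof.
move=> px d0 ey ey' ab ab'.
have fr k i j := @det3_free x t o k i j d0.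
have lin := line_pair_neq fr ey ab; have lin' := line_pair_neq fr ey' ab'.
(* Moving [t] and [o] into [m] along [x] changes only the coefficients on [x], so the value does not
   depend on [m]. *)
have cr m : is_line m -> x \notin m ->
  cross_ratio ((<[x]> + <[y]>) :&: m) ((<[x]> + <[y']>) :&: m)
    ((<[x]> + <[o]>) :&: m) ((<[x]> + <[t]>) :&: m) = (a * b') / (a' * b).
  move=> lm xm.
  have [i fm] := line_shift t lm xm; have [j em] := line_shift o lm xm.
  set f := t + _ in fm; set e := o + _ in em.
  have -> : y = a *: f + b *: e + (c - a * i - b * j) *: x.
    rewrite ey /f /e; apply/rowP => k; rewrite !mxE; ring.
  have -> : y' = a' *: f + b' *: e + (c' - a' * i - b' * j) *: x.
    rewrite ey' /f /e; apply/rowP => k; rewrite !mxE; ring.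
  have {1}-> : o = 0 *: f + 1 *: e + (- j) *: x.
    rewrite /e; apply/rowP => k; rewrite !mxE; ring.
  have -> : t = 1 *: f + 0 *: e + (- i) *: x.
    rewrite /f; apply/rowP => k; rewrite !mxE; ring.
  rewrite !pencil_capE // !scale0r !scale1r add0r addr0.
  apply: cross_ratio_pair => k l ekl.
  have [|_ -> -> //] := fr (l * i + k * j) l k.
  by rewrite -ekl /e /f; apply/rowP => r; rewrite !mxE; ring.
have fr0 k i j : k *: x + i *: t + j *: o = 0 -> i = 0 /\ j = 0 by case/fr.
(* A direction whose line is L has no component on [t], and below, one whose line is T has none on
   [o]. This settles the fixed-line alternative. *)
have onL z i j k : z = i *: t + j *: o + k *: x ->
    (<[x]> + <[z]>)%VS = (<[x]> + <[o]>)%VS -> i = 0.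
  move=> ez e; have : z \in (<[x]> + <[o]>)%VS by rewrite -e memvE addvSr.
  case/memv_pair=> r [r' er]; have [|//] := fr0 (k - r) i (j - r').
  transitivity (z - z); last exact: subrr.
  by rewrite {1}ez er; apply/rowP => u; rewrite !mxE; ring.
have onT z i j k : z = i *: t + j *: o + k *: x ->
    (<[x]> + <[z]>)%VS = (<[x]> + <[t]>)%VS -> j = 0.
  move=> ez e; have : z \in (<[x]> + <[t]>)%VS by rewrite -e memvE addvSr.
  case/memv_pair=> r [r' er]; have [|//] := fr0 (k - r) (i - r') j.
  transitivity (z - z); last exact: subrr.
  by rewrite {1}ez er; apply/rowP => u; rewrite !mxE; ring.
split.
  case=> _ _ _ _ [h|[yy' [eL|eT]]]; last 2 first.
  - by rewrite (onL _ _ _ _ ey eL) (onL _ _ _ _ ey' (etrans (esym yy') eL)) !mul0r addr0.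
  - by rewrite (onT _ _ _ _ ey eT) (onT _ _ _ _ ey' (etrans (esym yy') eT)) !mulr0 addr0.
  (* One transversal is enough to extract the equation; the line joining [t] and [o] avoids [x]. *)
  have lto : is_line (<[t]> + <[o]>)%VS.
    apply: (@line_pair_neq t o o x 0 1 0); rewrite ?scale0r ?scale1r ?add0r ?addr0 //.
      by move=> k i j; rewrite [_ *: t + _]addrC => /fr[-> -> ->].
    by rewrite oner_eq0 orbT.
  have xto : x \notin (<[t]> + <[o]>)%VS.
    apply/memv_pair => -[k [i ex]]; have [|/eqP] := fr 1 (- k) (- i); last by rewrite oner_eq0.
    by rewrite scale1r {1}ex; apply/rowP => u; rewrite !mxE; ring.
  have := h _ lto; rewrite px -memvE => /(_ xto); rewrite cr // => e.
  (* A zero denominator would give the value 0 instead of -1. *)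
  have ba0 : a' * b != 0.
    by apply/eqP => ba; move/eqP: e; rewrite ba invr0 mulr0 eq_sym oppr_eq0 oner_eq0.
  by rewrite -(divfK ba0 (a * b')) e mulN1r addNr.
move=> h; split=> //; rewrite ?px ?addvSl //.
(* For [b = 0] both lines are T, and for [a = 0] both are L. The quotient is then 0 by convention,
   so the fixed-line alternative must be chosen. *)
have [b0|b0] := eqVneq b 0.
  move: ab; rewrite b0 eqxx orbF => a0; move/eqP: h.
  rewrite b0 mulr0 addr0 mulf_eq0 (negPf a0) => /eqP b'0.
  move: ab'; rewrite b'0 eqxx orbF => a'0.
  by right; rewrite ey ey' b0 b'0 !scale0r !addr0 !line_pair_shift //; split=> //; right.
have [a0|a0] := eqVneq a 0.
  move/eqP: h; rewrite a0 mul0r add0r mulf_eq0 (negPf b0) orbF => /eqP a'0.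
  move: ab'; rewrite a'0 eqxx => b'0.
  by right; rewrite ey ey' a0 a'0 !scale0r !add0r !line_pair_shift //; split=> //; left.
left=> m lm; rewrite px -memvE => xm; rewrite cr //.
have a'0 : a' != 0.
  apply: contraTneq ab' => a'0; move/eqP: h; rewrite a'0 mul0r addr0 mulf_eq0 (negPf a0) /=.
  by move=> ->; rewrite eqxx.
have eh := addr0_eq h.
by rewrite -eh invrN mulrN divff // -oppr_eq0 eh mulf_neq0.
Qed.

End Coordinates.

(** * One reflection step in coordinates on three consecutive edges *)

Section Step.
Set Implicit Arguments.
Unset Strict Implicit.
Unset Printing Implicit Defensive.
Variables (R : realType) (u v w : 'rV[R]_3) (O : ppoint R).
Hypothesis uvw : det3 u v w != 0.
Hypothesis Ouw : (O : {vspace _}) = <[u + w]>%VS.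
Implicit Types (p q r : ppoint R) (s t : R) (x y : 'rV[R]_3).

Lemma ppoint_neq0 p x : (p : {vspace _}) = <[x]>%VS -> x != 0.
Proof. by move=> px; move: (dim_ppoint p); rewrite px dim_vline; case: (x != 0). Qed.

Lemma line_scale k x : k != 0 -> <[k *: x]>%VS = <[x]>%VS.
Proof.
move=> k0; apply/eqP; rewrite eqEsubv -!memvE memvZ ?memv_line //=.
by rewrite -{1}(scalerK k0 x) memvZ ?memv_line.
Qed.

Lemma ppoint_eq p q x y a b c d :
  (p : {vspace _}) = <[a *: x + b *: y]>%VS -> (q : {vspace _}) = <[c *: x + d *: y]>%VS ->
  b != 0 -> d != 0 -> a * d = b * c -> p = q.
Proof.
move=> pE qE b0 d0 e; apply: val_inj; rewrite /= pE qE -(line_scale _ d0) -(line_scale (c *: x + _) b0).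
by rewrite !scalerDr !scalerA (mulrC d a) (mulrC d b) e.
Qed.

(* [a] and [b] are the coordinates, modulo [x], of the incoming direction in the
   basis [w], [u + w], and [a'], [b'] those of the outgoing one. *)
Lemma reflected_coord p q r s t s' t' s'' t'' :
  (p : {vspace _}) = <[s *: u + t *: v]>%VS ->
  (q : {vspace _}) = <[s' *: v + t' *: w]>%VS ->
  (r : {vspace _}) = <[s'' *: w + t'' *: (u + w - v)]>%VS ->
  s' != 0 -> t' != 0 ->
  reflected q (<[v]> + <[w]>)%VS (q + O)%VS (p + q)%VS (q + r)%VS <->
    s * s' * s'' = t'' * (s * s' + t * t' - s * t').
Proof.
move=> pE qE rE s'0 t'0; set x := s' *: v + t' *: w in qE.
have -> : (<[v]> + <[w]> = <[x]> + <[w]>)%VS.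
  by rewrite addvC [RHS]addvC line_pair_shift.
rewrite [(p + q)%VS]addvC pE rE Ouw qE.
(* These come from substituting [v = (x - t' *: w) / s'] and collecting the terms in [w], [u + w]
   and [x]. *)
set a := - (s + t * t' / s'); set a' := s'' + t'' * t' / s'.
have d0 : det3 x w (u + w) != 0.
  rewrite (_ : det3 _ _ _ = s' * det3 u v w) ?mulf_neq0 //.
  by rewrite /x !det3E !mxE; ring.
rewrite (reflectedE (a := a) (b := s) (c := t / s') (a' := a') (b' := t'') (c' := - (t'' / s')) qE d0).
- split=> h.
    suff : s' * (a * t'' + a' * s) = s * s' * s'' - t'' * (s * s' + t * t' - s * t').
      by rewrite h mulr0 => /esym/subr0_eq.
    by rewrite /a /a'; field.
  apply: (mulfI s'0); rewrite mulr0 -[RHS](subrr (s * s' * s'')) {2}h /a /a'.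
  by field.
- by rewrite /a /x; apply/rowP => i; rewrite !mxE; field.
- by rewrite /a' /x; apply/rowP => i; rewrite !mxE; field.
- apply/orP; have [s0|] := eqVneq s 0; [left|by right].
  rewrite /a s0 add0r oppr_eq0 !mulf_neq0 ?invr_eq0 //.
  by apply: contraNneq (ppoint_neq0 pE) => ->; rewrite s0 !scale0r addr0.
- apply/orP; have [t0|] := eqVneq t'' 0; [left|by right].
  rewrite /a' t0 !mul0r addr0.
  by apply: contraNneq (ppoint_neq0 rE) => ->; rewrite t0 !scale0r addr0.
Qed.

(** The relation of [reflected_coord] is linear in the pair of [r], and the coefficient [s * s'] is
    nonzero, so it fixes the ratio of the pair. *)
Lemma reflected_next p q r r' s t s' t' :
  (p : {vspace _}) = <[s *: u + t *: v]>%VS ->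
  (q : {vspace _}) = <[s' *: v + t' *: w]>%VS ->
  s != 0 -> s' != 0 -> t' != 0 ->
  (r <= <[w]> + <[u + w - v]>)%VS -> (r' <= <[w]> + <[u + w - v]>)%VS ->
  reflected q (<[v]> + <[w]>)%VS (q + O)%VS (p + q)%VS (q + r)%VS ->
  reflected q (<[v]> + <[w]>)%VS (q + O)%VS (p + q)%VS (q + r')%VS ->
  r = r'.
Proof.
move=> pE qE s0 s'0 t'0 /ppoint_on[a [b [rE r0]]] /ppoint_on[a' [b' [r'E r'0]]].
rewrite (reflected_coord pE qE rE s'0 t'0) (reflected_coord pE qE r'E s'0 t'0).
set C := _ - _ => h h'; have ss0 : s * s' != 0 by exact: mulf_neq0.
apply: (ppoint_eq rE r'E).
- apply: contraNneq r0 => b0; move/eqP: h; rewrite b0 mul0r mulf_eq0 (negPf ss0) => /eqP ->.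
  by rewrite !scale0r addr0.
- apply: contraNneq r'0 => b0; move/eqP: h'; rewrite b0 mul0r mulf_eq0 (negPf ss0) => /eqP ->.
  by rewrite !scale0r addr0.
- apply: (mulfI ss0); rewrite mulrA h mulrCA h'; ring.
Qed.

(** The same relation, collected in the pair of [p], is again linear; now the nonzero coefficient is
    [t' * t'']. *)
Lemma reflected_prev p p' q r s' t' s'' t'' :
  (q : {vspace _}) = <[s' *: v + t' *: w]>%VS ->
  (r : {vspace _}) = <[s'' *: w + t'' *: (u + w - v)]>%VS ->
  s' != 0 -> t' != 0 -> t'' != 0 ->
  (p <= <[u]> + <[v]>)%VS -> (p' <= <[u]> + <[v]>)%VS ->
  reflected q (<[v]> + <[w]>)%VS (q + O)%VS (p + q)%VS (q + r)%VS ->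
  reflected q (<[v]> + <[w]>)%VS (q + O)%VS (p' + q)%VS (q + r)%VS ->
  p = p'.
Proof.
move=> qE rE s'0 t'0 t''0 /ppoint_on[a [b [pE p0]]] /ppoint_on[a' [b' [p'E p'0]]].
rewrite (reflected_coord pE qE rE s'0 t'0) (reflected_coord p'E qE rE s'0 t'0) => h h'.
have tt0 : t' * t'' != 0 by exact: mulf_neq0.
set C := s' * s'' - t'' * s' + t'' * t'.
have {}h : a * C = b * (t' * t'').
  by apply/eqP; rewrite -subr_eq0; apply/eqP; rewrite -[RHS](subrr (a * s' * s'')) {2}h /C; ring.
have {}h' : a' * C = b' * (t' * t'').
  by apply/eqP; rewrite -subr_eq0; apply/eqP; rewrite -[RHS](subrr (a' * s' * s'')) {2}h' /C; ring.
(* [ppoint_eq] asks for a nonzero second coefficient; here the coefficient known to be nonzero is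
   the one of [u]. *)
rewrite ![_ *: u + _]addrC in pE p'E p0 p'0.
apply: (ppoint_eq pE p'E).
- apply: contraNneq p0 => a0; move/esym/eqP: h; rewrite a0 mul0r mulf_eq0 (negPf tt0) orbF => /eqP ->.
  by rewrite !scale0r addr0.
- apply: contraNneq p'0 => a0; move/esym/eqP: h'; rewrite a0 mul0r mulf_eq0 (negPf tt0) orbF => /eqP ->.
  by rewrite !scale0r addr0.
- apply: (mulIf tt0); rewrite mulrAC -h -[RHS]mulrA -h'; ring.
Qed.
End Step.

(** * Open subsets of the projective plane *)

Section OpenSets.
Set Implicit Arguments.
Unset Strict Implicit.
Unset Printing Implicit Defensive.
Variable R : realType.
Local Open Scope classical_set_scope.

(** Rescaling a representative multiplies [f] by a positive square, so the sign does not depend on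
    the vector picked and the cone is the preimage of the positive half-line. *)
Lemma open_quadratic (f : 'rV[R]_3 -> R) : continuous f ->
  (forall k z, f (k *: z) = k ^+ 2 * f z) ->
  open [set p : ppoint R | 0 < f (vpick p)].
Proof.
move=> fc fh; rewrite (_ : open _ = point_open [set p | 0 < f (vpick p)]) // /point_open.
rewrite (_ : cone _ = f @^-1` [set r | 0 < r]); last first.
  apply/seteqP; split=> z /=.
    case=> p /= + pz; rewrite pz; have [k k0 ->] := vpick_line z.
    by rewrite fh pmulr_rgt0 // exprn_even_gt0.
  move=> fz; have [z0|z0] := eqVneq z 0.
    by move: fz; rewrite z0 -(scale0r z) fh expr0n mul0r ltxx.
  have [p pz] := point_of_vec z0; exists p => //=.
  rewrite pz; have [k k0 ->] := vpick_line z.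
  by rewrite fh pmulr_rgt0 // exprn_even_gt0.
by apply: open_comp => [z _|]; [exact: fc|exact: open_gt].
Qed.

Lemma continuous_det3 (u v : 'rV[R]_3) : continuous (fun z => det3 z u v).
Proof.
pose c1 := u 0 1 * v 0 2%:R - u 0 2%:R * v 0 1.
pose c2 := u 0 0 * v 0 2%:R - u 0 2%:R * v 0 0.
pose c3 := u 0 0 * v 0 1 - u 0 1 * v 0 0.
rewrite (_ : (fun _ => _) = (fun z : 'rV[R]_3 => z 0 0 * c1 - z 0 1 * c2 + z 0 2%:R * c3)); last first.
  by apply/funext => z; rewrite det3E.
have cc i c : continuous (fun z : 'rV[R]_3 => z 0 i * c).
  by move=> z; apply: continuousM; [exact: coord_continuous|exact: cst_continuous].
have cDB (f g h : 'rV[R]_3 -> R) : continuous f -> continuous g -> continuous h ->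
    continuous (fun z => f z - g z + h z).
  move=> cf cg ch z; apply: (@continuousD R R^o _ (fun z => f z - g z) h); last exact: ch.
  by apply: (@continuousB R R^o _ f g); [exact: cf|exact: cg].
by apply: cDB; exact: cc.
Qed.

End OpenSets.

(** * Adapted vectors for a non-degenerate quadrilateral *)

Section Quad.
Set Implicit Arguments.
Unset Strict Implicit.
Unset Printing Implicit Defensive.
Variable R : realType.

Lemma collinear_sub (p q r : ppoint R) : (r <= p + q)%VS -> collinear p q r.
Proof.
move=> rpq; have [->|/dim_join pq] := pselect (p = q); first exact: collinear_eq.
by exists (p + q)%VS; rewrite addvSl addvSr.
Qed.

Lemma noncollinear_det3 (p q r : ppoint R) u v w :
  (p : {vspace _}) = <[u]>%VS -> (q : {vspace _}) = <[v]>%VS -> (r : {vspace _}) = <[w]>%VS ->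
  ~ collinear p q r -> det3 u v w != 0.
Proof.
move=> pE qE rE nc.
have solve (x y z : 'rV[R]_3) a b c : a *: x + b *: y + c *: z = 0 ->
    c != 0 -> (<[z]> <= <[x]> + <[y]>)%VS.
  move=> e c0; rewrite -memvE -(scalerK c0 z) memvZ //; apply/memv_pair.
  exists (- a), (- b); transitivity ((a *: x + b *: y + c *: z) - a *: x - b *: y).
    by apply/rowP => i; rewrite !mxE; ring.
  by rewrite e sub0r !scaleNr.
apply: det3_neq0 => a b c e; split; apply/eqP; apply: contraT => h0; case: nc.
- have [|l [? ? ? ?]] := @collinear_sub q r p; last by exists l.
  by rewrite pE qE rE (solve _ _ _ b c a) // -e addrC addrA.
- have [|l [? ? ? ?]] := @collinear_sub r p q; last by exists l.
  by rewrite pE qE rE (solve _ _ _ c a b) // -e [RHS]addrC addrA.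
- by apply: collinear_sub; rewrite pE qE rE (solve _ _ _ a b c).
Qed.

Lemma Z4_ind (Q : 'Z_4 -> Prop) : Q 0 -> Q 1 -> Q 2%:R -> Q 3%:R -> forall k, Q k.
Proof.
move=> q0 q1 q2 q3 [[|[|[|[|//]]]] i].
- by rewrite (_ : Ordinal i = 0) //; exact: val_inj.
- by rewrite (_ : Ordinal i = 1) //; exact: val_inj.
- by rewrite (_ : Ordinal i = 2%:R) //; exact: val_inj.
- by rewrite (_ : Ordinal i = 3%:R) //; exact: val_inj.
Qed.

(** A vector spanning [O] is decomposed along each diagonal, and its components are the wanted
    vectors. A zero component would place [O] at a vertex, hence on an edge. *)
Lemma quad_vectors (P : 'Z_4 -> ppoint R) (O : ppoint R) :
  nondegenerate_quad P ->
  (O : {vspace _}) = ((P 0%R + P 2%R) :&: (P 1%R + P 3%R))%VS ->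
  exists v o, [/\ forall k, (P k : {vspace _}) = <[v k]>%VS,
    (O : {vspace _}) = <[o]>%VS & forall k, v k + v (k + 1 + 1) = o].
Proof.
move=> nd hO; have edgeO := diagonals_off_edges nd hO.
set o := vpick O; have [dg02 dg13] : o \in (P 0%R + P 2%R)%VS /\ o \in (P 1%R + P 3%R)%VS.
  by apply/andP; rewrite -memv_cap -hO memv_pick.
have coef0 k l a b : o = a *: vpick (P k) + b *: vpick (P l) -> a != 0.
  move=> e; apply/eqP => a0; have := edgeO l; rewrite (ppointE O) -/o -memvE e a0 scale0r add0r.
  by rewrite memvZ // (subvP (addvSl _ _)) ?memv_pick.
move: dg02 dg13; rewrite (ppointE (P 0)) (ppointE (P 1)) (ppointE (P 2%:R)) (ppointE (P 3%:R)).
move=> /memv_pair[a0 [a2 e02]] /memv_pair[a1 [a3 e13]].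
pose a (k : 'Z_4) := nth 0 [:: a0; a1; a2; a3] k.
exists (fun k => a k *: vpick (P k)), o; split.
- have aneq k : a k != 0.
    move: k; apply: Z4_ind.
    + exact: coef0 e02.
    + exact: coef0 e13.
    + by apply: (coef0 2%:R 0); rewrite addrC; exact: e02.
    + by apply: (coef0 3%:R 1); rewrite addrC; exact: e13.
  by move=> k; rewrite line_scale // -ppointE.
- exact: ppointE.
have E20 : 2%:R + 1 + 1 = 0 :> 'Z_4 by exact: val_inj.
have E31 : 3%:R + 1 + 1 = 1 :> 'Z_4 by exact: val_inj.
have E02 : 0 + 1 + 1 = 2%:R :> 'Z_4 by exact: val_inj.
have E13 : 1 + 1 + 1 = 3%:R :> 'Z_4 by exact: val_inj.
apply: Z4_ind; rewrite ?E20 ?E31 ?E02 ?E13.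
- by rewrite e02.
- by rewrite e13.
- by rewrite e02 addrC.
- by rewrite e13 addrC.
Qed.
End Quad.

(** * Sign conditions on the coordinates of a point of an edge *)

Section OpenCoordinates.
Set Implicit Arguments.
Unset Strict Implicit.
Unset Printing Implicit Defensive.
Variable R : realType.

Lemma open_det3M (a b c d : 'rV[R]_3) :
  open [set p : ppoint R | 0 < det3 (vpick p) a b * det3 (vpick p) c d]%classic.
Proof.
have cM (f g : 'rV[R]_3 -> R) : continuous f -> continuous g ->
    continuous (fun z => f z * g z).
  by move=> cf cg z; apply: continuousM; [exact: cf|exact: cg].
apply: (@open_quadratic R (fun z => det3 z a b * det3 z c d)).
  by apply: cM; exact: continuous_det3.
by move=> k z; rewrite !det3E !mxE; ring.
Qed.

Variables (u v w : 'rV[R]_3) (p : ppoint R) (a b : R).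
Hypothesis uvw : det3 u v w != 0.
Hypothesis pE : (p : {vspace _}) = <[a *: u + b *: v]>%VS.

(** By Cramer's rule the two determinants are [a] and [b] times the same factor, which enters the
    product squared. *)
Lemma det3M_gt0 : (0 < det3 (vpick p) v w * det3 (vpick p) w u) = (0 < a * b).
Proof.
rewrite pE; have [k k0 ->] := vpick_line (a *: u + b *: v).
rewrite (_ : _ * _ = (k * det3 u v w) ^+ 2 * (a * b)).
  by rewrite pmulr_rgt0 // exprn_even_gt0 //= mulf_neq0.
by rewrite !det3E !mxE; ring.
Qed.

(** Putting [u + v] in the last slot gives a form vanishing at [u + v], so [b] is replaced by
    [b - a]. *)
Lemma det3M_sub_gt0 :
  (0 < det3 (vpick p) v w * det3 (vpick p) w (u + v)) = (0 < a * (b - a)).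
Proof.
rewrite pE; have [k k0 ->] := vpick_line (a *: u + b *: v).
rewrite (_ : _ * _ = (k * det3 u v w) ^+ 2 * (a * (b - a))).
  by rewrite pmulr_rgt0 // exprn_even_gt0 //= mulf_neq0.
by rewrite !det3E !mxE; ring.
Qed.
End OpenCoordinates.

(** * Closed orbits from cyclic coordinates, and their uniqueness *)

Section Orbit.
Set Implicit Arguments.
Unset Strict Implicit.
Unset Printing Implicit Defensive.
Variables (R : realType) (P : 'Z_4 -> ppoint R) (O : ppoint R).
Hypothesis P_neq : forall k, P k <> P (k + 1).
Hypothesis O_off : forall k, ~~ (O <= P k + P (k + 1)%R)%VS.
Variables (v : 'Z_4 -> 'rV[R]_3) (o : 'rV[R]_3).
Hypothesis PE : forall k, (P k : {vspace _}) = <[v k]>%VS.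
Hypothesis OE : (O : {vspace _}) = <[o]>%VS.
Hypothesis vo : forall k, v k + v (k + 1 + 1) = o.
Hypothesis vd : forall k, det3 (v k) (v (k + 1)) (v (k + 1 + 1)) != 0.
Variables (s t : 'Z_4 -> R) (n : 'Z_4 -> ppoint R).
Hypothesis nE : forall k, (n k : {vspace _}) = <[s k *: v k + t k *: v (k + 1)%R]>%VS.
Hypothesis s_neq0 : forall k, s k != 0.
Hypothesis t_neq0 : forall k, t k != 0.
Hypothesis st : forall k, s k * s (k + 1) * s (k + 1 + 1) =
  t (k + 1 + 1) * (s k * s (k + 1) + t k * t (k + 1) - s k * t (k + 1)).

Let B := CPol (isT : (2 < 4)%N) P_neq O_off.

(** Both pairs of opposite vectors have sum [o]. The result is the vector [u + w - v] of
    [reflected_coord]. *)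
Lemma vertex_opp k : v (k + 1 + 1 + 1) = v k + v (k + 1 + 1) - v (k + 1).
Proof. by rewrite vo -(vo (k + 1)) [RHS]addrAC subrr add0r. Qed.

Lemma center_eq k : (O : {vspace _}) = <[v k + v (k + 1 + 1)%R]>%VS.
Proof. by rewrite vo. Qed.

Lemma edgeE k : edge B k = (<[v k]> + <[v (k + 1)%R]>)%VS.
Proof. by rewrite -!PE. Qed.

Lemma on_edge k : (n k <= edge B k)%VS.
Proof. by rewrite edgeE nE -memvE; apply/memv_pair; exists (s k), (t k). Qed.

Lemma n_neq k : n k <> n (k + 1).
Proof.
move=> e; have : s k *: v k + t k *: v (k + 1) \in (n (k + 1) : {vspace _}).
  by rewrite -e nE memv_line.
rewrite nE => /vlineP[c h].
have [|/eqP] := @det3_free _ _ _ _ (s k) (t k - c * s (k + 1)) (- (c * t (k + 1))) (vd k); last first.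
  by rewrite (negPf (s_neq0 k)).
transitivity ((s k *: v k + t k *: v (k + 1)) - c *: (s (k + 1) *: v (k + 1) + t (k + 1) *: v (k + 1 + 1))).
  by apply/rowP => i; rewrite !mxE; ring.
by rewrite h subrr.
Qed.

Lemma n_reflected k : reflected (n (k + 1)) (edge B (k + 1)) (n (k + 1)%R + O)%VS
  (n k + n (k + 1)%R)%VS (n (k + 1)%R + n (k + 1 + 1)%R)%VS.
Proof.
have h := nE (k + 1 + 1); rewrite vertex_opp in h.
by rewrite edgeE (reflected_coord (vd k) (center_eq k) (nE k) (nE (k + 1)) h) //; exact: st.
Qed.

(** Reading the index in ['Z_4] makes the sequence 4-periodic by construction; the closing of the
    orbit is contained in [st] holding cyclically. *)
Definition closed_orbit (k : int) : ppoint R := n k%:~R.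

Lemma closed_orbitP : is_orbit B closed_orbit.
Proof.
move=> k; rewrite /closed_orbit intrD intrB; split.
- exact: on_edge.
- exact: n_neq.
(* [n_reflected] is centred at the successor of its index. *)
- by have := n_reflected (k%:~R - 1); rewrite subrK.
Qed.

Lemma orbit_next M k : is_orbit B M -> M k = closed_orbit k ->
  M (k + 1) = closed_orbit (k + 1) -> M (k + 1 + 1) = closed_orbit (k + 1 + 1).
Proof.
rewrite /closed_orbit !intrD => oM e0 e1; set j : 'Z_4 := k%:~R.
have [_ _] := oM (k + 1); rewrite addrK e0 e1 intrD -/j => h.
have [h2 _ _] := oM (k + 1 + 1); rewrite !intrD -/j edgeE vertex_opp in h2.
have h3 := on_edge (j + 1 + 1); rewrite edgeE vertex_opp in h3.
have h4 := n_reflected j; rewrite edgeE in h4 h.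
by apply: (reflected_next (vd j) (center_eq j) (nE j) (nE (j + 1))) h2 h3 h h4.
Qed.

Lemma orbit_prev M k : is_orbit B M -> M (k + 1) = closed_orbit (k + 1) ->
  M (k + 1 + 1) = closed_orbit (k + 1 + 1) -> M k = closed_orbit k.
Proof.
rewrite /closed_orbit !intrD => oM e1 e2; set j : 'Z_4 := k%:~R.
have [_ _] := oM (k + 1); rewrite addrK e1 e2 intrD -/j => h.
have [h2 _ _] := oM k; rewrite -/j edgeE in h2.
have h3 := on_edge j; rewrite edgeE in h3.
have h4 := n_reflected j; rewrite edgeE in h4 h.
have h5 := nE (j + 1 + 1); rewrite vertex_opp in h5.
by apply: (reflected_prev (vd j) (center_eq j) (nE (j + 1)) h5) h2 h3 h h4.
Qed.

(** Two consecutive points determine their neighbours on both sides, so an induction carrying such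
    pairs runs forward and another backward. *)
Lemma closed_orbit_unique : unique (orbit_of B (n 0) (n 1)) closed_orbit.
Proof.
split; first by split; [| |exact: closed_orbitP].
move=> M [M0 M1 oM]; apply/esym/funext => k.
have pos (j : nat) : M j%:Z = closed_orbit j%:Z /\ M (j%:Z + 1) = closed_orbit (j%:Z + 1).
  elim: j => [|j [IH1 IH2]]; first by rewrite add0r M0 M1.
  by rewrite -[in j.+1]addn1 PoszD; split=> //; exact: orbit_next.
have neg (j : nat) : M (- j%:Z) = closed_orbit (- j%:Z) /\
    M (- j%:Z + 1) = closed_orbit (- j%:Z + 1).
  elim: j => [|j [IH1 IH2]]; first by rewrite oppr0 add0r M0 M1.
  have e : - j.+1%:Z + 1 = - j%:Z by rewrite -[in j.+1]addn1 PoszD opprD subrK.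
  by rewrite e; split=> //; apply: orbit_prev; rewrite // e.
by case: (intP k) => [|j|j]; [have [] := pos 0%N|have [] := pos j.+1|have [] := neg j.+1].
Qed.

Lemma closed_orbit_periodic : periodic_orbit 4 closed_orbit.
Proof.
rewrite /periodic_orbit /closed_orbit intrD.
by rewrite (_ : 4%:Z%:~R = 0 :> 'Z_4) ?add0r //; exact: val_inj.
Qed.
End Orbit.

(** * The open sets of starting points and the cyclic coordinates of their orbits *)

Theorem proposition1p3 (R : realType) (P : 'Z_4 -> ppoint R) (O : ppoint R)
    (hP : nondegenerate_quad P)
    (hO : (O : {vspace 'rV[R]_3}) = ((P 0%R + P 2%R) :&: (P 1%R + P 3%R))%VS) :
  reflective
    (CPol (isT : (2 < 4)%N) (quad_vertex_neq hP) (diagonals_off_edges hP hO)) 4.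
Proof.
have [v [w [PE OE vw]]] := quad_vectors hP hO.
have vd k : det3 (v k) (v (k + 1)) (v (k + 1 + 1)) != 0.
  apply: (noncollinear_det3 (PE _) (PE _) (PE _)); apply: hP; by move: k; apply: Z4_ind.
set B := CPol _ _ _.
split=> //.
(* Positivity of [q0] and [q1] encodes [a * (b - a) > 0] on edge 0 and [c * d > 0] on edge 1. *)
pose q0 (p : ppoint R) := det3 (vpick p) (v 1) (v 2%:R) * det3 (vpick p) (v 2%:R) (v 0 + v 1).
pose q1 (p : ppoint R) := det3 (vpick p) (v 2%:R) (v 3%:R) * det3 (vpick p) (v 3%:R) (v 1).
exists ([set p | 0 < q0 p] `&` points_on (edge B 0))%classic.
exists ([set p | 0 < q1 p] `&` points_on (edge B 1))%classic.
have vd0 : det3 (v 0) (v 1) (v 2%:R) != 0 by have := vd 0; rewrite !add0r.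
have E3 : 1 + 1 + 1 = 3%:R :> 'Z_4 by exact: val_inj.
have vd1 : det3 (v 1) (v 2%:R) (v 3%:R) != 0 by rewrite -E3; exact: (vd 1).
have edge0 : edge B 0 = (<[v 0%R]> + <[v 1%R]>)%VS by rewrite (edgeE _ _ PE) add0r.
have edge1 : edge B 1 = (<[v 1%R]> + <[v 2%R]>)%VS by rewrite (edgeE _ _ PE).
split; first by split; exact: subIsetr.
- by split; rewrite open_subspaceIT; apply: open_subspaceW; exact: open_det3M.
- split.
    (* The coordinates (1, 2) give [a * (b - a) = 1]. *)
    have [|p pE] := @point_of_vec R (1 *: v 0 + 2%:R *: v 1).
      apply/eqP => e; have [|/eqP] := @det3_free _ _ _ _ 1 2%:R 0 vd0; last by rewrite oner_eq0.
      by rewrite scale0r addr0.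
    exists p; split; first by rewrite /= /q0 (det3M_sub_gt0 vd0 pE); lra.
    by rewrite /points_on /= edge0 pE -memvE; apply/memv_pair; exists 1, 2%:R.
  have [|p pE] := @point_of_vec R (1 *: v 1 + 1 *: v 2%:R).
    apply/eqP => e; have [|/eqP] := @det3_free _ _ _ _ 1 1 0 vd1; last by rewrite oner_eq0.
    by rewrite scale0r addr0.
  exists p; split; first by rewrite /= /q1 (det3M_gt0 vd1 pE); lra.
  by rewrite /points_on /= edge1 pE -memvE; apply/memv_pair; exists 1, 1.
move=> M0 M1 [/= h0]; rewrite /points_on /= edge0 => /ppoint_on[a [b [M0E _]]].
move=> [/= h1]; rewrite /points_on /= edge1 => /ppoint_on[c [d [M1E _]]].
move: h0 h1; rewrite /q0 /q1 (det3M_sub_gt0 vd0 M0E) (det3M_gt0 vd1 M1E) => h0 h1.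
pose Q := a * c + b * d - a * d.
pose s (k : 'Z_4) := nth 0 [:: a; c; Q; b * d] k.
pose t (k : 'Z_4) := nth 0 [:: b; d; a * c; Q] k.
have a0 : a != 0 by apply/eqP => e; move: h0; rewrite e mul0r ltxx.
have c0 : c != 0 by apply/eqP => e; move: h1; rewrite e mul0r ltxx.
have d0 : d != 0 by apply/eqP => e; move: h1; rewrite e mulr0 ltxx.
have b0 : b != 0 by apply/eqP => e; move: h0; rewrite e; nra.
have Q0 : Q != 0.
  (* Multiplied by [a * d], the number [Q] becomes a combination of the two positive quantities with
     squares as coefficients. *)
  have : 0 < a * d * Q.
    rewrite (_ : _ * Q = a ^+ 2 * (c * d) + d ^+ 2 * (a * (b - a))); last by rewrite /Q; ring.
    by apply: addr_gt0; apply: mulr_gt0 => //; rewrite exprn_even_gt0.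
  by move=> h; apply/eqP => e; move: h; rewrite e mulr0 ltxx.
have s0 k : s k != 0 by move: k; apply: Z4_ind; rewrite /s /= ?mulf_neq0.
have t0 k : t k != 0 by move: k; apply: Z4_ind; rewrite /t /= ?mulf_neq0.
(* Indices 0 and 1 produce the third and fourth points; indices 2 and 3 express the closing. The
   relation is homogeneous in each pair, so the original [(a, b)] and [(c, d)] can be reused
   there. *)
have st k : s k * s (k + 1) * s (k + 1 + 1) =
    t (k + 1 + 1) * (s k * s (k + 1) + t k * t (k + 1) - s k * t (k + 1)).
  by move: k; apply: Z4_ind; rewrite /s /t /= /Q; ring.
have /choice[n nE] : forall k, exists p : ppoint R,
    (p : {vspace _}) = <[s k *: v k + t k *: v (k + 1)%R]>%VS.
  move=> k; apply: point_of_vec; apply/eqP => e.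
  have [|/eqP] := @det3_free _ _ _ _ (s k) (t k) 0 (vd k); last by rewrite (negPf (s0 k)).
  by rewrite scale0r addr0.
exists (closed_orbit n); split; last exact: closed_orbit_periodic.
have -> : M0 = n 0 by apply: val_inj; rewrite /= nE M0E add0r.
have -> : M1 = n 1 by apply: val_inj; rewrite /= nE M1E.
exact: (closed_orbit_unique _ _ PE OE vw vd nE s0 t0 st).
Qed.
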